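(* For a space $X$ and an infinite set $\mathcal{A}$, the following are equivalent: (i) Each convex-valued l.s.c. mapping $\Phi:X\rightrightarrows\mathbf{c}_{00}(\mathcal{A})$ has, for every $\varepsilon>0$, a continuous $\varepsilon$-selection. (ii) Each convex-valued l.s.c. mapping $\Phi:X\rightrightarrows\ell_1(\mathcal{A})$ has, for every $\varepsilon>0$, a continuous $\varepsilon$-selection. (iii) Each open cover $\{U_\alpha:\alpha\in\mathcal{A}\}$ of $X$ indexed by $\mathcal{A}$ has an index-subordinated partition of unity.
   Context: $\ell_1(\mathcal{A})$ is the Banach space of $y:\mathcal{A}\to\mathbb{R}$ with $\|y\|_1=\sum_\alpha|y(\alpha)|<\infty$; $\mathbf{c}_{00}(\mathcal{A})$ is its (normed, non-complete) subspace of finitely supported functions with the $\|\cdot\|_1$ norm. A set-valued mapping $\Phi:X\rightrightarrows Y$ assigns nonempty subsets; it is l.s.c. if $\{x:\Phi(x)\cap U\ne\emptyset\}$ is open for every open $U\subseteq Y$, and convex-valued if every $\Phi(x)$ is convex. For a metric space $(Y,d)$, a map $f:X\to Y$ is an $\varepsilon$-selection for $\Phi$ if for every $x$ there is $y\in\Phi(x)$ with $d(f(x),y)<\varepsilon$. A partition of unity indexed by $\mathcal{A}$ is a family of continuous $\xi_\alpha:X\to[0,1]$ with $\sum_\alpha\xi_\alpha(x)=1$ for all $x$; it is index-subordinated to $\{U_\alpha\}$ if $\{x:\xi_\alpha(x)\neq0\}\subseteq U_\alpha$ for all $\alpha$. *)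

(* Defs.v *)
From HB Require Import structures.
From mathcomp Require Import all_boot all_order all_algebra.
From mathcomp Require Import all_classical all_reals all_analysis.
Set Implicit Arguments. Unset Strict Implicit. Unset Printing Implicit Defensive.
Import Order.TTheory GRing.Theory Num.Theory numFieldTopology.Exports numFieldNormedType.Exports.
Local Open Scope classical_set_scope.
Local Open Scope ring_scope.

Section L1.
Variables (R : realType) (A : choiceType).

Definition l1norm (y : A -> R) : \bar R := \esum_(a in [set: A]) (`|y a|)%:E.

Definition ell1 : set (A -> R) := [set y | (l1norm y < +oo)%E].

(* c_00(A): finitely supported functions (with the l_1 norm) *)
Definition c00 : set (A -> R) := [set y | finite_set [set a | y a != 0]].

Definition l1dist (y z : A -> R) : \bar R := l1norm (y - z).

Definition open_in (S U : set (A -> R)) : Prop :=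
  U `<=` S /\
  forall y, U y -> exists2 r : R, 0 < r &
    forall z, S z -> (l1dist z y < r%:E)%E -> U z.

Definition convex_set (C : set (A -> R)) : Prop :=
  forall y z (t : R), C y -> C z -> 0 <= t -> t <= 1 ->
    C (t *: y + (1 - t) *: z).

Variable X : topologicalType.

Definition setvalued_into (S : set (A -> R)) (Phi : X -> set (A -> R)) : Prop :=
  forall x, Phi x !=set0 /\ Phi x `<=` S.

Definition lsc (S : set (A -> R)) (Phi : X -> set (A -> R)) : Prop :=
  forall U, open_in S U -> open [set x | Phi x `&` U !=set0].

Definition convex_valued (Phi : X -> set (A -> R)) : Prop :=
  forall x, convex_set (Phi x).

Definition continuous_into (S : set (A -> R)) (f : X -> A -> R) : Prop :=
  (forall x, S (f x)) /\
  forall x (e : R), 0 < e -> \forall x' \near x, (l1dist (f x') (f x) < e%:E)%E.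

Definition eps_selection (Phi : X -> set (A -> R)) (eps : R) (f : X -> A -> R) : Prop :=
  forall x, exists2 y, Phi x y & (l1dist (f x) y < eps%:E)%E.

Definition selection_property (S : set (A -> R)) : Prop :=
  forall Phi : X -> set (A -> R),
    setvalued_into S Phi -> convex_valued Phi -> lsc S Phi ->
    forall eps : R, 0 < eps ->
      exists f : X -> A -> R, continuous_into S f /\ eps_selection Phi eps f.

Definition partition_of_unity (xi : A -> X -> R) : Prop :=
  (forall a, continuous (xi a)) /\
  (forall a x, 0 <= xi a x <= 1) /\
  (forall x, \esum_(a in [set: A]) (xi a x)%:E = 1%E).

Definition index_subordinated (xi : A -> X -> R) (U : A -> set X) : Prop :=
  forall a, [set x | xi a x != 0] `<=` U a.

Definition open_cover_indexed (U : A -> set X) : Prop :=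
  (forall a, open (U a)) /\ \bigcup_(a in [set: A]) U a = [set: X].

End L1.

(* Main.v *)
Require Import Defs.
From HB Require Import structures.
From mathcomp Require Import all_boot all_order all_algebra finmap ring lra.
From mathcomp Require Import all_classical all_reals all_analysis.
Set Implicit Arguments. Unset Strict Implicit. Unset Printing Implicit Defensive.
Import Order.TTheory GRing.Theory Num.Theory.
Import numFieldTopology.Exports numFieldNormedType.Exports.
Local Open Scope classical_set_scope.
Local Open Scope card_scope.
Local Open Scope ring_scope.

(* Both selection properties are compared with the partition property, for an
   arbitrary [S] with [c00 `<=` S `<=` ell1].

   From selections to partitions: for a cover [U], let [Phi x] be the convex
   hull of the unit vectors [e_a] with [U a x].  A vector of [Phi x] lies in
   [Phi x'] for all [x'] near [x], so that [Phi], as well as its intersections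
   with balls centered at a continuous function, is l.s.c.  Iterating yields
   [2^-n]-selections whose uniform limit is a continuous selection of the
   closure of [Phi] in [ell1]; its coordinates form the partition.

   From partitions to selections: since [A] is infinite, [|A * A| = |A|], so the
   finitely supported rational vectors, which are dense in [ell1], can be
   enumerated as [d a], [a : A].  The sets of those [x] for which [Phi x] meets
   the ball of radius [e] about [d a] form an open cover.  A partition of unity
   subordinated to it can be truncated to a locally finite family of weights,
   and the barycenter of the [d a] for these weights is an [e]-selection: it
   stays in the [e]-neighbourhood of [Phi x], which is convex. *)

(** * Squares of infinite sets *)

Section ZornInjection.
Variables T U : Type.
Implicit Types (F : set (set T)) (G : set T) (f : T -> U).

Lemma total_bigcup2 F x y : total_on F subset ->
  (\bigcup_(X in F) X) x -> (\bigcup_(X in F) X) y ->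
  exists2 X, F X & X x /\ X y.
Proof.
move=> tF [X FX Xx] [Y FY Yy].
by have [/(_ _ Xx) ?|/(_ _ Yy) ?] := tF _ _ FX FY; [exists Y|exists X].
Qed.

Lemma set_inj_bigcup F f : total_on F subset ->
  (forall X, F X -> set_inj X f) -> set_inj (\bigcup_(X in F) X) f.
Proof.
move=> tF Finj x y /set_mem Fx /set_mem Fy.
by have [X FX [Xx Xy]] := total_bigcup2 tF Fx Fy; apply: (Finj X); rewrite ?inE.
Qed.

Lemma set_injU (G H : set T) f : set_inj G f -> set_inj H f ->
  f @` G `&` f @` H = set0 -> set_inj (G `|` H) f.
Proof.
move=> Ginj Hinj GH0 x y /set_mem[Gx|Hx] /set_mem[Gy|Hy] fxy.
- by apply: Ginj; rewrite ?inE.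
- by have : set0 (f x) by rewrite -GH0; split; [exists x|exists y].
- by have : set0 (f x) by rewrite -GH0; split; [exists y|exists x].
- by apply: Hinj; rewrite ?inE.
Qed.

Lemma Zorn_bigcup_above (P : set (set T)) G : P G ->
  (forall F, F !=set0 -> F `<=` P -> total_on F subset -> P (\bigcup_(X in F) X)) ->
  exists M, [/\ G `<=` M, P M & forall N, M `<=` N -> P N -> N `<=` M].
Proof.
move=> PG Pchain; have [|M [PM Mmax]] := @Zorn_bigcup _ (fun X => P (G `|` X)).
  move=> F FP tF; have [->|/set0P F0] := eqVneq F set0.
    by rewrite bigcup_set0 setU0.
  have -> : G `|` \bigcup_(X in F) X = \bigcup_(Y in setU G @` F) Y.
    rewrite bigcup_image; apply/seteqP; split=> [x [Gx|[X FX Xx]]|x [X FX [Gx|Xx]]].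
    - by have [X FX] := F0; exists X => //; left.
    - by exists X => //; right.
    - by left.
    - by right; exists X.
  apply: Pchain; first by have [X FX] := F0; exists (G `|` X), X.
    by move=> _ [X FX <-]; exact: FP.
  move=> _ _ [X FX <-] [Y FY <-].
  by have [XY|YX] := tF _ _ FX FY; [left|right]; exact: setUS.
exists (G `|` M); split=> // N MN PN; apply: contrapT => nNM.
apply: (Mmax N).
  split; first by move=> x Mx; apply: MN; right.
  by move=> NM; apply: nNM => x /NM; right.
by rewrite (iffRL (setUidPr _ _))// => x Gx; apply: MN; left.
Qed.

End ZornInjection.

Lemma card_le_total T U (B : set T) (C : set U) : B #<= C \/ C #<= B.
Proof.
pose P (G : set (T * U)) := [/\ G `<=` B `*` C, set_inj G fst & set_inj G snd].
have [||G [_ [GBC Ginj1 Ginj2] Gmax]] := @Zorn_bigcup_above _ P set0.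
- by split=> // x y /set_mem.
- move=> F _ FP tF; split.
  + by apply: bigcup_sub => X /FP[].
  + by apply: set_inj_bigcup => // X /FP[].
  + by apply: set_inj_bigcup => // X /FP[].
have card1 := inj_card_eq Ginj1; have card2 := inj_card_eq Ginj2.
have le12 : fst @` G #<= snd @` G.
  by rewrite (card_le_eql card1) (card_le_eqr card2) card_lexx.
have le21 : snd @` G #<= fst @` G.
  by rewrite (card_le_eql card2) (card_le_eqr card1) card_lexx.
have sub1 : fst @` G `<=` B by move=> _ [p /GBC[? _] <-].
have sub2 : snd @` G `<=` C by move=> _ [p /GBC[_ ?] <-].
have [BG|/existsNP[b /not_implyP[Bb nb]]] := pselect (B `<=` fst @` G).
  left; apply: card_le_trans (subset_card_le sub2).
  exact: card_le_trans (subset_card_le BG) le12.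
have [CG|/existsNP[c /not_implyP[Cc nc]]] := pselect (C `<=` snd @` G).
  right; apply: card_le_trans (subset_card_le sub1).
  exact: card_le_trans (subset_card_le CG) le21.
have set_inj_set1 V (f : T * U -> V) : set_inj [set (b, c)] f.
  by move=> x y /set_mem-> /set_mem->.
have /(_ (b, c) (or_intror erefl)) Gbc : G `|` [set (b, c)] `<=` G.
  apply: Gmax; first by left.
  split; first by rewrite subUset; split=> // _ ->.
    apply: set_injU => //; rewrite image_set1; apply/disjoints_subset.
    by move=> x + /= xb; rewrite xb.
  apply: set_injU => //; rewrite image_set1; apply/disjoints_subset.
  by move=> x + /= xc; rewrite xc.
by exfalso; apply: nb; exists (b, c).
Qed.

Section GraphOn.
Variables (V W : Type) (B : set V) (h : V -> W).

Definition graph_on : set (V * W) := [set (b, h b) | b in B].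

Lemma image_fst_graph_on : fst @` graph_on = B.
Proof.
by rewrite image_comp; apply/seteqP; split=> [_ [b ? <-]//|b Bb]; exists b.
Qed.

Lemma image_snd_graph_on : snd @` graph_on = h @` B.
Proof. exact: image_comp. Qed.

Lemma set_inj_fst_graph_on : set_inj graph_on fst.
Proof. by move=> _ _ /set_mem[b _ <-] /set_mem[c _ <-] /= ->. Qed.

Lemma set_inj_snd_graph_on : set_inj B h -> set_inj graph_on snd.
Proof.
move=> hinj _ _ /set_mem[b Bb <-] /set_mem[c Bc <-] /= bc.
by rewrite (hinj b c) ?inE.
Qed.

End GraphOn.

Section InfiniteSquare.
Variable T : pointedType.
Implicit Types (D B C : set T) (G : set (T * T * T)).

Lemma card_le_injP V (B : set V) C :
  B #<= C <-> exists2 f : V -> T, set_fun B C f & set_inj B f.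
Proof. by rewrite -injfunPex; split=> /pcard_leP. Qed.

Lemma card_le_setX B C D : B #<= D -> C #<= D -> B `*` C #<= D `*` D.
Proof.
move=> /card_le_injP[f fD finj] /card_le_injP[g gD ginj].
apply/pcard_leP/injfunPex; exists (fun p => (f p.1, g p.2)).
  by move=> [b c] [/fD ? /gD ?].
move=> [b c] [b' c'] /set_mem[/= Bb Cc] /set_mem[/= Bb' Cc'] [fbb' gcc'].
by rewrite (finj b b') ?inE// (ginj c c') ?inE.
Qed.

Lemma card_le_setU B C D : infinite_set D -> D `*` D #<= D ->
  B #<= D -> C #<= D -> B `|` C #<= D.
Proof.
move=> /infiniteP/card_le_injP[i iD iinj] DD /card_le_injP[f fD finj].
move=> /card_le_injP[g gD ginj]; apply: card_le_trans DD.
apply/pcard_leP/injfunPex.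
have inC x : (B `|` C) x -> x \notin B -> C x by rewrite notin_setE => -[].
exists (fun x => if x \in B then (i 0%N, f x) else (i 1%N, g x)).
  move=> x BCx; case: ifPn => [/set_mem Bx|nBx]; split; try exact: iD.
    exact: fD.
  by apply: gD; exact: inC nBx.
have i01 : i 0%N <> i 1%N by move/iinj; rewrite !inE => /(_ I I).
move=> x y /set_mem BCx /set_mem BCy.
case: ifPn => xB; case: ifPn => yB [] //.
- exact: finj.
- by move=> /esym.
- by apply: ginj; apply/mem_set; exact: inC.
Qed.

Definition diag_dom G : set T := [set a | (fst @` G) (a, a)].

(* [G] is the graph of an injection [D * D -> D], where [D := diag_dom G]. *)
Definition square_injection G : Prop :=
  [/\ set_inj G fst, set_inj G snd, fst @` G = diag_dom G `*` diag_dom G &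
      snd @` G `<=` diag_dom G].

Lemma square_injection_card_le G :
  square_injection G -> diag_dom G `*` diag_dom G #<= diag_dom G.
Proof.
move=> [inj1 inj2 <- sub2]; apply: card_le_trans (subset_card_le sub2).
by rewrite (card_le_eql (inj_card_eq inj1)) (card_le_eqr (inj_card_eq inj2)) card_lexx.
Qed.

Lemma square_injection_bigcup (F : set (set (T * T * T))) :
  F `<=` square_injection -> total_on F subset ->
  square_injection (\bigcup_(X in F) X).
Proof.
move=> FS tF.
have diagS X : F X -> diag_dom X `<=` diag_dom (\bigcup_(X in F) X).
  by move=> FX a [p Xp pa]; exists p => //; exists X.
split.
- by apply: set_inj_bigcup => // X /FS[].
- by apply: set_inj_bigcup => // X /FS[].
- apply/seteqP; split=> [_ [p [X FX Xp] <-]|[a b] [/= [p Fp pa] [q Fq qb]]].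
    have [_ _ EX _] := FS _ FX.
    have : (fst @` X) p.1 by exists p.
    by rewrite EX => -[? ?]; split; exact: diagS FX _ _.
  have [X FX [Xp Xq]] := total_bigcup2 tF Fp Fq.
  have [_ _ EX _] := FS _ FX.
  have : (diag_dom X `*` diag_dom X) (a, b) by split; [exists p|exists q].
  by rewrite -EX => -[r Xr <-]; exists r => //; exists X.
- move=> _ [p [X FX Xp] <-]; have [_ _ _ sX] := FS _ FX.
  by apply: (diagS X) => //; apply: sX; exists p.
Qed.

Lemma diag_domX D G : fst @` G = D `*` D -> diag_dom G = D.
Proof. by rewrite /diag_dom => ->; apply/seteqP; split=> a; [case|]. Qed.

Lemma square_injection_graph D (f : T * T -> T) :
  set_fun (D `*` D) D f -> set_inj (D `*` D) f ->
  square_injection (graph_on (D `*` D) f).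
Proof.
move=> fD finj; have diagG := diag_domX (image_fst_graph_on (D `*` D) f).
split; rewrite ?diagG.
- exact: set_inj_fst_graph_on.
- exact: set_inj_snd_graph_on.
- exact: image_fst_graph_on.
- by rewrite image_snd_graph_on => _ [p Dp <-]; exact: fD.
Qed.

(* The new pairs of [(D `|` B) `*` (D `|` B)] are sent into [B], which is as large
   as [D]. *)
Lemma square_injection_extend G B : square_injection G ->
  infinite_set (diag_dom G) -> diag_dom G #= B -> diag_dom G `&` B = set0 ->
  exists2 H, G `<=` H & square_injection H /\ diag_dom H = diag_dom G `|` B.
Proof.
set D := diag_dom G => SG Dinf DB DB0; have DD := square_injection_card_le SG.
have [Ginj1 Ginj2 fstG sndG] := SG.
set N := ((D `|` B) `*` (D `|` B)) `\` (D `*` D).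
have UD : D `|` B #<= D.
  by apply: card_le_setU => //; rewrite -?(card_le_eql DB) card_lexx.
have /card_le_injP[h hB hinj] : N #<= B.
  rewrite -(card_le_eqr DB); apply: card_le_trans (card_le_setD _ _) _.
  exact: card_le_trans (card_le_setX UD UD) DD.
have fstH := image_fst_graph_on N h.
have sndH : snd @` graph_on N h `<=` B.
  by rewrite image_snd_graph_on => _ [p Np <-]; exact: hB.
have fstU : fst @` (G `|` graph_on N h) = (D `|` B) `*` (D `|` B).
  by rewrite image_setU fstG fstH setDUK// => -[a b] [? ?]; split; left.
have diagU := diag_domX fstU.
exists (G `|` graph_on N h); first by left.
split=> //; split; rewrite ?diagU//.
- apply: set_injU => //; first exact: set_inj_fst_graph_on.
  by rewrite fstG fstH setDIK.
- apply: set_injU => //; first exact: set_inj_snd_graph_on.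
  by apply/disjoints_subset => x /sndG Dx /sndH Bx; rewrite -[False]/(set0 x) -DB0.
- by rewrite image_setU; exact: setUSS.
Qed.

Lemma infinite_card_square :
  infinite_set [set: T] -> [set: T * T] #<= [set: T].
Proof.
move=> /infiniteP/card_le_injP[i _ iinj].
have [|f fi finj] := (card_le_injP (range i `*` range i) (range i)).1 _.
  apply: card_le_trans (countableX _ _) _; try exact: card_image_le.
  by rewrite (card_le_eqr (inj_card_eq iinj)) card_lexx.
have [|G [fG SG Gmax]] := Zorn_bigcup_above (square_injection_graph fi finj).
  by move=> F _; exact: square_injection_bigcup.
set D := diag_dom G.
have Dinf : infinite_set D.
  apply: (@sub_infinite_set _ (range i)).
    rewrite -(diag_domX (image_fst_graph_on (range i `*` range i) f)).
    by move=> a [p fp pa]; exists p => //; exact: fG.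
  by apply/infiniteP; rewrite (card_le_eqr (inj_card_eq iinj)) card_lexx.
have DD := square_injection_card_le SG.
have [nDD|/card_le_injP[g gnD ginj]] := card_le_total (~` D) D.
  have TD : [set: T] #<= D.
    by rewrite -(setUv D); apply: card_le_setU => //; exact: card_lexx.
  rewrite -setXTT; apply: card_le_trans (card_le_setX TD TD) _.
  exact: card_le_trans DD (card_leT _).
have [||H GH [SH diagH]] := square_injection_extend (B := g @` D) SG Dinf.
- by rewrite card_eq_sym inj_card_eq.
- by apply/disjoints_subset => a Da [b Db gb]; have := gnD _ Db; rewrite gb.
have [d Dd] := infinite_setN0 Dinf.
have [] := gnD _ Dd; have : diag_dom H (g d) by rewrite diagH; right; exists d.
by move=> [p Hp pg]; exists p => //; exact: Gmax Hp.
Qed.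

End InfiniteSquare.

Lemma infinite_nat_inj (A : Type) :
  infinite_set [set: A] -> exists i : nat -> A, injective i.
Proof.
elim/Ppointed: A => A Ainf; first by have [] := infinite_setN0 Ainf.
have [i _ iinj] := (card_le_injP _ _).1 ((infiniteP _).1 Ainf).
by exists i => m n; apply: iinj; rewrite inE.
Qed.

Lemma infinite_pair_inj (A : Type) :
  infinite_set [set: A] -> exists p : A * A -> A, injective p.
Proof.
elim/Ppointed: A => A Ainf; first by have [] := infinite_setN0 Ainf.
have [p _ pinj] := (card_le_injP _ _).1 (infinite_card_square Ainf).
by exists p => x y; apply: pinj; rewrite inE.
Qed.

Lemma infinite_seq_inj (A : Type) :
  infinite_set [set: A] -> exists c : seq A -> A, injective c.
Proof.
move=> Ainf; have [p pinj] := infinite_pair_inj Ainf.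
have [i iinj] := infinite_nat_inj Ainf.
exists (foldr (fun a c => p (i 1%N, p (a, c))) (p (i 0%N, i 0%N))).
elim=> [|a s IH] [|b t] //= /pinj[].
- by move=> /iinj.
- by move=> /iinj.
- by move=> /pinj[-> /IH ->].
Qed.

Lemma infinite_fsfun_inj (A : choiceType) (V : countType) (v : V) :
  infinite_set [set: A] -> exists c : {fsfun A -> V with v} -> A, injective c.
Proof.
move=> Ainf; have [p pinj] := infinite_pair_inj Ainf.
have [i iinj] := infinite_nat_inj Ainf.
have [c cinj] := infinite_seq_inj Ainf.
pose graph (g : {fsfun A -> V with v}) :=
  [seq p (a, i (choice.pickle (g a))) | a <- finsupp g].
have graphP g a w : w != v ->
    (p (a, i (choice.pickle w)) \in graph g) = (g a == w).
  move=> wv; apply/mapP/eqP => [[b _]|ga].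
    by move=> /pinj[-> /iinj/(pcan_inj choice.pickleK) ->].
  by exists a; rewrite ?ga// mem_finsupp ga.
exists (c \o graph) => g h /cinj gh; apply/fsfunP => a.
have [ga|ga] := eqVneq (g a) v; last first.
  by apply/esym/eqP; rewrite -graphP// -gh graphP.
have [//|ha] := eqVneq (h a) v; first by rewrite ga.
by apply/eqP; rewrite -graphP// gh graphP.
Qed.

(** * The norm of l1 *)

Section UnconditionalSums.
Variables (R : realType) (A : choiceType).
Implicit Types (f : A -> R) (F : {fset A}).

Lemma ge0_esumZl (S : set A) (f : A -> \bar R) (r : R) : 0 <= r ->
  (forall a, 0 <= f a)%E ->
  (\esum_(a in S) (r%:E * f a) = r%:E * \esum_(a in S) f a)%E.
Proof.
move=> r0 f0; rewrite /esum -ereal_supZl//; last first.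
  by apply/set0P; exists (\sum_(a \in set0) f a)%E, set0 => //; exact: fsets_set0.
rewrite image_comp; congr ereal_sup; apply: eq_imagel => X [Xfin XS] /=.
by rewrite ge0_mule_fsumr.
Qed.

Lemma esum_fset_lower f F : (forall a, 0 <= f a) ->
  ((\sum_(a <- F) f a)%:E <= \esum_(a in [set: A]) (f a)%:E)%E.
Proof.
move=> f0; apply: esum_ge; exists [set` F]; first by split.
by rewrite fsbig_finite//= set_fsetK sumEFin.
Qed.

Lemma lt_esum_fset f (r : R) : (r%:E < \esum_(a in [set: A]) (f a)%:E)%E ->
  exists F, r < \sum_(a <- F) f a.
Proof.
move=> /ereal_sup_gt[_ [X [Xfin _] <-]].
by rewrite fsbig_finite//= sumEFin lte_fin; exists (fset_set X).
Qed.

Lemma esum_fsetE f F : (forall a, 0 <= f a) ->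
  (\esum_(a in [set` F]) (f a)%:E = (\sum_(a <- F) f a)%:E)%E.
Proof.
move=> f0; rewrite esum_fset//; last by move=> a _; rewrite lee_fin.
by rewrite fsbig_finite//= set_fsetK sumEFin.
Qed.

End UnconditionalSums.

Section L1Norm.
Variables (R : realType) (A : choiceType).
Implicit Types (y z w : A -> R) (F : {fset A}) (C : set (A -> R)) (r t e : R).

Lemma l1norm_ge0 y : (0 <= l1norm y)%E.
Proof. by apply: esum_ge0 => a _; rewrite lee_fin. Qed.

Lemma l1norm0 : l1norm (0 : A -> R) = 0%E.
Proof. by apply: esum1 => a _; rewrite normr0. Qed.

Lemma l1normZ t y : l1norm (t *: y) = (`|t|%:E * l1norm y)%E.
Proof.
rewrite -ge0_esumZl//.
by apply: eq_esum => a _; rewrite !fctE normrZ EFinM.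
Qed.

Lemma ge0_l1normE y : (forall a, 0 <= y a) ->
  l1norm y = \esum_(a in [set: A]) (y a)%:E.
Proof. by move=> y0; apply: eq_esum => a _; rewrite ger0_norm. Qed.

Lemma ge0_l1normD y z : (forall a, 0 <= y a) -> (forall a, 0 <= z a) ->
  l1norm (y + z) = (l1norm y + l1norm z)%E.
Proof.
move=> y0 z0; rewrite -esumD => [|a _|a _]; rewrite ?lee_fin//.
by apply: eq_esum => a _; rewrite !fctE !ger0_norm ?addr_ge0.
Qed.

Lemma le_l1normD y z : (l1norm (y + z)%R <= l1norm y + l1norm z)%E.
Proof.
rewrite -esumD => [|a _|a _]; rewrite ?lee_fin//.
by apply: le_esum => a _; rewrite -EFinD lee_fin !fctE ler_normD.
Qed.

Lemma le_l1norm_sum (I : Type) (s : seq I) (v : I -> A -> R) :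
  (l1norm (\sum_(i <- s) v i)%R <= \sum_(i <- s) l1norm (v i))%E.
Proof.
elim: s => [|i s IH]; first by rewrite !big_nil l1norm0.
by rewrite !big_cons; apply: le_trans (le_l1normD _ _) _; exact: leeD2l.
Qed.

Lemma normr_le_l1norm y a : (`|y a|%:E <= l1norm y)%E.
Proof.
by apply: le_trans (esum_fset_lower [fset a]%fset _) => //; rewrite big_seq_fset1.
Qed.

Lemma l1norm_fset y F : (forall a, a \notin F -> y a = 0) ->
  l1norm y = (\sum_(a <- F) `|y a|)%:E.
Proof.
move=> yF; rewrite -esum_fsetE// [RHS]esum_mkcond; apply: eq_esum => a _.
by case: ifPn => //; rewrite notin_setE => /negP/yF ->; rewrite normr0.
Qed.

Lemma l1distxx y : l1dist y y = 0%E.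
Proof. by rewrite /l1dist subrr l1norm0. Qed.

Lemma l1distC y z : l1dist y z = l1dist z y.
Proof. by apply: eq_esum => a _; rewrite !fctE distrC. Qed.

Lemma l1dist_triangle y z w : (l1dist y w <= l1dist y z + l1dist z w)%E.
Proof. by apply: le_trans (le_l1normD _ _); rewrite addrA subrK. Qed.

Lemma l1dist_triangle_lt y z w r e :
  (l1dist y z < r%:E -> l1dist z w < e%:E -> l1dist y w < (r + e)%:E)%E.
Proof.
by move=> yz zw; apply: le_lt_trans (l1dist_triangle _ z _) _; rewrite EFinD lteD.
Qed.

Lemma l1dist_lt_shrink y z r : (l1dist y z < r%:E)%E ->
  exists2 e, 0 < e & (l1dist y z < (r - e)%:E)%E.
Proof.
have := l1norm_ge0 (y - z); rewrite /l1dist; case: (l1norm _) => [s||]// _.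
rewrite lte_fin => sr; exists ((r - s) / 2); first lra.
by rewrite lte_fin; lra.
Qed.

Lemma l1norm_convex_lt y z r t : 0 <= t -> t <= 1 ->
  (l1norm y < r%:E -> l1norm z < r%:E ->
   l1norm (t *: y + (1 - t) *: z)%R < r%:E)%E.
Proof.
move=> t0 t1 yr zr; apply: le_lt_trans (le_l1normD _ _) _.
rewrite !l1normZ (ger0_norm t0) ger0_norm ?subr_ge0//.
have := l1norm_ge0 y; have := l1norm_ge0 z; move: yr zr.
case: (l1norm y) => [p||]//; case: (l1norm z) => [q||]//.
rewrite !lte_fin => pr qr _ _.
have mr : Num.max p q < r by rewrite gt_max pr.
have pm : p <= Num.max p q by rewrite le_max lexx.
have qm : q <= Num.max p q by rewrite le_max lexx orbT.
by apply: le_lt_trans mr; nra.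
Qed.

Lemma l1dist_convex_lt y y' z z' r t : 0 <= t -> t <= 1 ->
  (l1dist y y' < r%:E -> l1dist z z' < r%:E ->
   l1dist (t *: y + (1 - t) *: z)%R (t *: y' + (1 - t) *: z')%R < r%:E)%E.
Proof.
move=> t0 t1 yr zr; rewrite /l1dist opprD addrACA -!scalerBr.
exact: l1norm_convex_lt.
Qed.

Definition l1ball z r : set (A -> R) := [set y | (l1dist y z < r%:E)%E].

Definition enlargement C r : set (A -> R) :=
  [set y | exists2 z, C z & (l1dist y z < r%:E)%E].

Lemma l1ball_convex z r : Defs.convex_set (l1ball z r).
Proof.
move=> y y' t yr yr' t0 t1; have <- : t *: z + (1 - t) *: z = z.
  by rewrite -scalerDl addrC subrK scale1r.
exact: l1dist_convex_lt.
Qed.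

Lemma enlargement_convex C r :
  Defs.convex_set C -> Defs.convex_set (enlargement C r).
Proof.
move=> cC y z t [y' Cy' yy'] [z' Cz' zz'] t0 t1.
by exists (t *: y' + (1 - t) *: z'); [exact: cC|exact: l1dist_convex_lt].
Qed.

Lemma convex_setI C D : Defs.convex_set C -> Defs.convex_set D ->
  Defs.convex_set (C `&` D).
Proof. by move=> cC cD y z t [? ?] [? ?] ? ?; split; [exact: cC|exact: cD]. Qed.

Lemma open_in_l1ball (S : set (A -> R)) z r : open_in S (S `&` l1ball z r).
Proof.
split=> [|y [Sy /l1dist_lt_shrink[e e0 yz]]]; first exact: subIsetl.
exists e => // w Sw wy; split=> //; rewrite /l1ball/= -[r](subrK e) addrC.
exact: l1dist_triangle_lt wy yz.
Qed.

End L1Norm.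

Section FiniteSupport.
Variables (R : realType) (A : choiceType).
Implicit Types (y : A -> R) (F : {fset A}).

Lemma c00P y : c00 y <-> exists F, forall a, a \notin F -> y a = 0.
Proof.
split=> [yfin|[F yF]].
  exists (fset_set [set a | y a != 0]) => a; rewrite in_fset_set// notin_setE/=.
  by move=> /negP; rewrite negbK => /eqP.
apply: (@sub_finite_set _ _ [set` F]) => // a /=.
by apply: contraNT => /yF ->.
Qed.

Lemma c00_ell1 : @c00 R A `<=` @ell1 R A.
Proof. by move=> y /c00P[F yF]; rewrite /ell1/= (l1norm_fset yF) ltry. Qed.

Lemma c00_convex : Defs.convex_set (@c00 R A).
Proof.
move=> y z t /c00P[F yF] /c00P[G zG] _ _; apply/c00P; exists (F `|` G)%fset => a.
by rewrite !inE negb_or => /andP[/yF ya /zG za]; rewrite !fctE ya za !scaler0 addr0.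
Qed.

Lemma ell1_tail y (e : R) : ell1 y -> 0 < e ->
  exists F, (\esum_(a in ~` [set` F]) `|y a|%:E < e%:E)%E.
Proof.
move=> y1 e0; have [r yr] : exists r : R, l1norm y = r%:E.
  by exists (fine (l1norm y)); rewrite fineK// ge0_fin_numE ?l1norm_ge0.
have [|F rF] := @lt_esum_fset _ _ (fun a => `|y a|) (r - e).
  by rewrite -/(l1norm y) yr lte_fin; lra.
exists F; move: yr; rewrite /l1norm (esumID [set` F]) => [|a _];
  last by rewrite lee_fin.
rewrite !setTI esum_fsetE//; case: (\esum_(_ in _) _)%E => [s [rs]| |]//.
by rewrite lte_fin; lra.
Qed.

Definition ratvec (g : {fsfun A -> rat with 0}) : A -> R := fun a => ratr (g a).

Lemma ratvec_c00 g : c00 (ratvec g).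
Proof.
by apply/c00P; exists (finsupp g) => a ga; rewrite /ratvec fsfun_dflt// rmorph0.
Qed.

Lemma ratvec_dense y (e : R) : ell1 y -> 0 < e ->
  exists g, (l1dist y (ratvec g) < e%:E)%E.
Proof.
move=> y1 e0; have [|F ytail] := ell1_tail y1 (e := e / 2); first lra.
pose d := e / 2 / #|` F|.+1%:R.
have d0 : 0 < d by rewrite !divr_gt0.
have /choice[q qd] a : exists q : rat, `|y a - ratr q| <= d.
  have [|q] := @rat_in_itvoo R (y a - d) (y a + d); first lra.
  rewrite in_itv/= => /andP[? ?]; exists q.
  by rewrite ler_norml; apply/andP; split; lra.
exists [fsfun a in F => q a].
rewrite /l1dist /l1norm (esumID [set` F]) => [|a _]; last by rewrite lee_fin.
rewrite !setTI esum_fsetE// [e]splitr EFinD lee_ltD//.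
  rewrite lee_fin.
  apply: (@le_trans _ _ (\sum_(a <- F) d)).
    rewrite big_seq [leRHS]big_seq; apply: ler_sum => a aF.
    by rewrite !fctE /ratvec fsfunE aF.
  rewrite big_const_seq count_predT iter_addr_0 -[leLHS]mulr_natr /d -mulrA.
  by rewrite ler_piMr ?ler_pdivrMl// ?mulr1 ?ler_nat//; lra.
rewrite (eq_esum (b := fun a => `|y a|%:E))// => a /= /negP aF.
by rewrite !fctE /ratvec fsfunE (negPf aF) rmorph0 subr0.
Qed.

Lemma infinite_l1_dense_family : infinite_set [set: A] ->
  exists d : A -> A -> R, (forall a, c00 (d a)) /\
  forall y (e : R), ell1 y -> 0 < e -> exists a, (l1dist y (d a) < e%:E)%E.
Proof.
move=> /(infinite_fsfun_inj (0 : rat))[c cinj].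
have /choice[g gP] a : exists g, forall h, c h = a -> h = g.
  have [[h ha]|na] := pselect (exists h, c h = a).
    by exists h => h'; rewrite -ha => /cinj.
  by exists [fsfun] => h ha; case: na; exists h.
exists (ratvec \o g); split=> [a|y e y1 e0]; first exact: ratvec_c00.
have [h yh] := ratvec_dense y1 e0.
by exists (c h); rewrite /= -(gP (c h) h erefl).
Qed.

End FiniteSupport.

Section Completeness.
Variables (R : realType) (A : choiceType).
Implicit Types (u : nat -> A -> R) (v : A -> R).

Lemma l1norm_le_cvg u v (r : R) : (forall a, u n a @[n --> \oo] --> v a) ->
  (\forall n \near \oo, (l1norm (u n) <= r%:E)%E) -> (l1norm v <= r%:E)%E.
Proof.
move=> uv ur; rewrite leNgt; apply/negP => /lt_esum_fset[F].
apply/negP; rewrite -leNgt.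
have cvgF : \sum_(a <- F) `|u n a| @[n --> \oo] --> \sum_(a <- F) `|v a|.
  by apply: cvg_big => [|a _]; [exact: add_continuous|apply: cvg_norm; exact: uv].
rewrite -(cvg_lim _ cvgF)//; apply: limr_le; first exact: cvgP cvgF.
apply: filterS ur => n un; rewrite -lee_fin; apply: le_trans un.
exact: (@esum_fset_lower _ _ (fun a => `|u n a|)).
Qed.

Lemma l1_cauchy_cvg u (r : nat -> R) : r n @[n --> \oo] --> 0 ->
  (forall n m, (n <= m)%N -> (l1dist (u m) (u n) <= (r n)%:E)%E) ->
  exists v, forall n, (l1dist v (u n) <= (r n)%:E)%E.
Proof.
move=> r0 ur.
have ucvg a : cvgn (fun n => u n a).
  apply/cauchy_cvgP/cauchy_exP => e e0.
  have [n _ rn] : \forall n \near \oo, r n < e by exact: cvgr_lt r0 _ e0.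
  exists (u n a), n => // m /= nm; rewrite -ball_normE/= distrC.
  apply: le_lt_trans (rn n (leqnn n)); rewrite -lee_fin.
  exact: le_trans (normr_le_l1norm (u m - u n) a) (ur _ _ nm).
exists (fun a => limn (fun n => u n a)) => n.
apply: (@l1norm_le_cvg (fun m => u m - u n)) => [a|].
  by apply: cvgB; [exact: ucvg|exact: cvg_cst].
by exists n => // m; exact: ur.
Qed.

End Completeness.

Section L1Continuity.
Variables (R : realType) (X : topologicalType) (A : choiceType).
Implicit Types (f g : X -> A -> R).

Definition l1continuous f : Prop :=
  forall x (e : R), 0 < e -> \forall x' \near x, (l1dist (f x') (f x) < e%:E)%E.

Lemma l1continuous_coord f a : l1continuous f -> continuous (f^~ a).
Proof.
move=> fc x; apply/cvgrPdist_lt => e e0; apply: filterS (fc x e e0) => x' fx'.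
rewrite -lte_fin distrC; apply: le_lt_trans fx'.
exact: (normr_le_l1norm (f x' - f x)).
Qed.

Lemma l1continuous_uniform_limit f :
  (forall e : R, 0 < e -> exists g,
     l1continuous g /\ forall x, (l1dist (f x) (g x) < e%:E)%E) ->
  l1continuous f.
Proof.
move=> fg x e e0; have [|g [gc fge]] := fg (e / 3); first lra.
have := gc x (e / 3) ltac:(lra); apply: filterS => x' gx'.
have -> : e = e / 3 + (e / 3 + e / 3) by lra.
apply: l1dist_triangle_lt (fge x') _; apply: l1dist_triangle_lt gx' _.
by rewrite l1distC.
Qed.

Lemma near_l1dist_sum (I : Type) (s : seq I) (c : I -> X -> R)
    (d : I -> A -> R) x (e : R) :
  (forall i, ell1 (d i)) -> (forall i, {for x, continuous (c i)}) -> 0 < e ->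
  \forall x' \near x,
    (l1dist (\sum_(i <- s) c i x' *: d i)%R (\sum_(i <- s) c i x *: d i)%R < e%:E)%E.
Proof.
move=> d1 cc e0.
pose N i := fine (l1norm (d i)).
have NE i : l1norm (d i) = (N i)%:E.
  by rewrite fineK// ge0_fin_numE ?l1norm_ge0//; exact: d1.
have Ncvg : \sum_(i <- s) `|c i x' - c i x| * N i @[x' --> x] -->
    \sum_(i <- s) `|c i x - c i x| * N i.
  apply: cvg_big => [|i _]; first exact: add_continuous.
  by apply: cvgMl; apply: cvg_norm; apply: cvgB; [exact: cc|exact: cvg_cst].
have : \forall x' \near x, \sum_(i <- s) `|c i x' - c i x| * N i < e.
  apply: (cvgr_lt _ Ncvg); rewrite big1// => i _.
  by rewrite subrr normr0 mul0r.
apply: filterS => x' small; rewrite /l1dist -sumrB.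
apply: le_lt_trans (le_l1norm_sum _ _) _.
under eq_bigr do rewrite -scalerBl l1normZ NE -EFinM.
by rewrite sumEFin lte_fin.
Qed.

End L1Continuity.

(** * From selections to partitions of unity *)

Section L1Closure.
Variables (R : realType) (A : choiceType).
Implicit Types (C : set (A -> R)) (y : A -> R).

Definition l1closure C : set (A -> R) :=
  [set y | forall e : R, 0 < e -> enlargement C e y].

Lemma l1closure_coord C (D : set R) y a : closed D ->
  (forall z, C z -> D (z a)) -> l1closure C y -> D (y a).
Proof.
move=> Dclosed CD yC; apply: Dclosed => B /nbhs_ballP[e e0 eB].
have [z Cz yz] := yC e e0; exists (z a); split; first exact: CD.
apply: eB; rewrite -ball_normE/= -lte_fin; apply: le_lt_trans yz.
exact: normr_le_l1norm (y - z) a.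
Qed.

Lemma l1closure_l1norm C y (r : R) : (forall z, C z -> l1norm z = r%:E) ->
  l1closure C y -> l1norm y = r%:E.
Proof.
move=> Cr yC; apply/eqP; rewrite eq_le; apply/andP; split;
  apply/lee_addgt0Pr => e e0; have [z /Cr zr yz] := yC e e0; rewrite -{}zr.
  rewrite -[in leLHS](subrK z y) addrC.
  by apply: le_trans (le_l1normD _ _) _; apply: leeD2l; exact: ltW.
rewrite -[in leLHS](subrK y z) addrC.
apply: le_trans (le_l1normD _ _) _; apply: leeD2l; apply: ltW.
by rewrite -/(l1dist z y) l1distC.
Qed.

End L1Closure.

Lemma cvg_half_powers (R : realType) (c : R) : c * 2 ^- n @[n --> \oo] --> 0.
Proof.
have -> : (fun n => c * 2 ^- n) = geometric c 2^-1.
  by apply/funext => n; rewrite /geometric/= exprVn.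
by apply: cvg_geometric; rewrite ger0_norm ?invr_ge0// invf_lt1// ltr1n.
Qed.

Lemma l1dist_half_powers (R : realType) (A : choiceType) (u : nat -> A -> R) (c : R) :
  (forall n, (l1dist (u n.+1) (u n) <= (c * 2 ^- n)%:E)%E) ->
  forall n m, (n <= m)%N -> (l1dist (u m) (u n) <= (2 * c * 2 ^- n)%:E)%E.
Proof.
move=> uc n m nm.
have c0 : 0 <= c.
  by have := le_trans (l1norm_ge0 _) (uc 0%N); rewrite expr0 invr1 mulr1 lee_fin.
suff : (l1dist (u m) (u n) <= (2 * c * (2 ^- n - 2 ^- m))%:E)%E.
  move=> /le_trans -> //; rewrite lee_fin ler_wpM2l ?mulr_ge0// gerBl.
  by rewrite invr_ge0 exprn_ge0.
rewrite -(subnKC nm); elim: (m - n)%N => [|k IH].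
  by rewrite addn0 subrr mulr0 l1distxx.
rewrite addnS; apply: le_trans (l1dist_triangle _ (u (n + k)%N) _) _.
apply: le_trans (leeD (uc _) IH) _; rewrite lee_fin exprSr invfM.
by lra.
Qed.

Section ClosureSelection.
Variables (R : realType) (X : topologicalType) (A : choiceType).
Variable S : set (A -> R).
Implicit Types (Phi : X -> set (A -> R)) (f g : X -> A -> R).

Definition open_fibers Phi : Prop :=
  forall y x, Phi x y -> \forall x' \near x, Phi x' y.

Lemma open_fibers_lsc Phi : open_fibers Phi -> lsc S Phi.
Proof.
move=> oPhi U _; rewrite openE => x [y [Py Uy]].
by apply: filterS (oPhi _ _ Py) => x' Py'; exists y.
Qed.

Lemma open_fibers_setI_l1ball Phi f (r : R) : open_fibers Phi -> l1continuous f ->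
  open_fibers (fun x => Phi x `&` l1ball (f x) r).
Proof.
move=> oPhi fc y x [Py /l1dist_lt_shrink[e e0 yf]].
apply: filterS2 (oPhi _ _ Py) (fc x e e0) => x' Py' fx'; split=> //.
rewrite /l1ball/= -[r](subrK e); apply: l1dist_triangle_lt yf _.
by rewrite l1distC.
Qed.

Hypothesis selS : selection_property X S.
Variable Phi : X -> set (A -> R).
Hypotheses (PhiS : setvalued_into S Phi) (Phi_convex : convex_valued Phi).
Hypothesis Phi_open : open_fibers Phi.

Lemma refine_selection f (r e : R) : continuous_into S f ->
  eps_selection Phi r f -> 0 < e ->
  exists g, [/\ continuous_into S g, eps_selection Phi e g &
    forall x, (l1dist (g x) (f x) < (e + r)%:E)%E].
Proof.
move=> [fS fc] fr e0.
have [||| g [gc gsel]] := selS (Phi := fun x => Phi x `&` l1ball (f x) r) _ _ _ e0.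
- move=> x; split; last by move=> y [/(PhiS x).2].
  by have [y Py fy] := fr x; exists y; split; rewrite // /l1ball/= l1distC.
- by move=> x; apply: convex_setI; [exact: Phi_convex|exact: l1ball_convex].
- exact/open_fibers_lsc/open_fibers_setI_l1ball.
exists g; split=> // x; have [y [Py yf] gy] := gsel x; first by exists y.
exact: l1dist_triangle_lt gy yf.
Qed.

Lemma selection_sequence : exists f : nat -> X -> A -> R, forall n,
  [/\ continuous_into S (f n), eps_selection Phi (2 ^- n) (f n) &
    forall x, (l1dist (f n.+1 x) (f n x) <= (2 * 2 ^- n)%:E)%E].
Proof.
pose Q (p : nat * (X -> A -> R)) :=
  continuous_into S p.2 /\ eps_selection Phi (2 ^- p.1) p.2.
have pow0 n : 0 < 2 ^- n :> R by rewrite invr_gt0 exprn_gt0.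
have [f0 Qf0] := selS PhiS Phi_convex (open_fibers_lsc Phi_open) (pow0 0%N).
pose next (p q : {p | Q p}) := (sval q).1 = (sval p).1.+1 /\
  forall x, (l1dist ((sval q).2 x) ((sval p).2 x) <= (2 * 2 ^- (sval p).1)%:E)%E.
have step p : {q | next p q}.
  apply: cid; case: p => -[n f] [fc fsel].
  have [g [gc gsel gf]] := refine_selection fc fsel (pow0 n.+1).
  exists (exist Q (n.+1, g) (conj gc gsel)); split=> //= x.
  apply: le_trans (ltW (gf x)) _; rewrite lee_fin exprSr invfM.
  by have := pow0 n; lra.
have [F [F0 Fnext]] := dependent_choice step (exist Q (0%N, f0) Qf0).
have F1 n : (sval (F n)).1 = n.
  by elim: n => [|n IH]; [rewrite F0|rewrite (Fnext n).1 IH].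
exists (fun n => (sval (F n)).2) => n.
by have [] := svalP (F n); have [_] := Fnext n; rewrite F1; split.
Qed.

Lemma l1closure_selection :
  exists f, l1continuous f /\ forall x, l1closure (Phi x) (f x).
Proof.
have [f fP] := selection_sequence.
have /choice[g gf] x : exists y, forall n, (l1dist y (f n x) <= (4 * 2 ^- n)%:E)%E.
  apply: l1_cauchy_cvg; first exact: cvg_half_powers.
  have -> : 4 = 2 * 2 :> R by ring.
  by apply: l1dist_half_powers => n; have [_ _] := fP n.
have half_power_lt (c e : R) : 0 < e -> exists n, c * 2 ^- n < e.
  move=> e0; have [n _ cn] : \forall n \near \oo, c * 2 ^- n < e.
    exact: cvgr_lt (cvg_half_powers c) _ e0.
  by exists n; exact: (cn n (leqnn n)).
exists g; split=> [|x e e0].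
  apply: l1continuous_uniform_limit => e e0; have [n ne] := half_power_lt 4 e e0.
  have [[_ fc] _ _] := fP n; exists (f n); split=> // x.
  by apply: le_lt_trans (gf x n) _; rewrite lte_fin.
have [n ne] := half_power_lt 5 e e0; have [_ fsel _] := fP n.
have [y Py fy] := fsel x; exists y => //.
apply: le_lt_trans (l1dist_triangle _ (f n x) _) _.
apply: le_lt_trans (leeD (gf x n) (ltW fy)) _.
by rewrite lte_fin; lra.
Qed.

End ClosureSelection.

Section CoverSimplex.
Variables (R : realType) (X : topologicalType) (A : choiceType).
Implicit Types (S : set (A -> R)) (U : A -> set X).

(* The convex hull of the unit vectors at the indices [a] with [U a x]. *)
Definition cover_simplex U (x : X) : set (A -> R) :=
  [set y | [/\ c00 y, forall a, 0 <= y a, forall a, y a != 0 -> U a x &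
    l1norm y = 1%E]].

Lemma cover_simplex_setvalued S U : @c00 R A `<=` S ->
  open_cover_indexed U -> setvalued_into S (cover_simplex U).
Proof.
move=> c00S [_ Ucover] x; split; last by move=> y [/c00S].
have [a _ Uax] : (\bigcup_(a in setT) U a) x by rewrite Ucover.
have supp b : b \notin [fset a]%fset -> (b == a)%:R = 0 :> R.
  by rewrite inE => /negPf ->.
exists (fun b => (b == a)%:R); split.
- by apply/c00P; exists [fset a]%fset.
- by move=> b; rewrite ler0n.
- by move=> b; have [->|] := eqVneq b a; rewrite ?eqxx.
- by rewrite (l1norm_fset supp) big_seq_fset1 eqxx normr1.
Qed.

Lemma cover_simplex_convex U : convex_valued (cover_simplex U).
Proof.
move=> x y z t [yfin y0 yU y1] [zfin z0 zU z1] t0 t1.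
have t'0 : 0 <= 1 - t by rewrite subr_ge0.
split.
- exact: c00_convex.
- by move=> a; rewrite addr_ge0// mulr_ge0.
- move=> a; have [ya|/yU//] := eqVneq (y a) 0.
  have [za|/zU//] := eqVneq (z a) 0.
  by rewrite !fctE ya za !scaler0 addr0 eqxx.
- rewrite ge0_l1normD => [|a|a]; try exact: mulr_ge0.
  by rewrite !l1normZ y1 z1 !mule1 !ger0_norm// -EFinD addrC subrK.
Qed.

Lemma cover_simplex_open_fibers U :
  open_cover_indexed U -> open_fibers (cover_simplex U).
Proof.
move=> [Uopen _] y x [yfin y0 yU y1]; have /c00P[F yF] := yfin.
have : \forall x' \near x, forall a, a \in F -> y a != 0 -> U a x'.
  apply: (@filter_bigI _ _ F (fun a => [set x' | y a != 0 -> U a x'])) => a _.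
  have [ya|/yU Uax] := eqVneq (y a) 0; first exact: nearW.
  by apply: filterS (open_nbhs_nbhs (conj (Uopen a) Uax)) => x' Ux' _.
apply: filterS => x' FU; split=> // a ya; apply: FU => //.
by apply: contraNT ya => /yF ->.
Qed.

Lemma selection_partition_of_unity S U : @c00 R A `<=` S ->
  selection_property X S -> open_cover_indexed U ->
  exists xi : A -> X -> R, partition_of_unity xi /\ index_subordinated xi U.
Proof.
move=> c00S selS oU.
have [f [fc fU]] := l1closure_selection selS (cover_simplex_setvalued c00S oU)
  (@cover_simplex_convex U) (cover_simplex_open_fibers oU).
have f0 x a : 0 <= f x a.
  apply: (@l1closure_coord _ _ _ [set t | 0 <= t] _ a _ _ (fU x)) => [|z [_ z0 _ _]].
    exact: closed_ge.
  exact: z0.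
have f1 x : l1norm (f x) = 1%E.
  by apply: (l1closure_l1norm _ (fU x)) => z [].
exists (fun a x => f x a); split; [split; [|split]|].
- by move=> a; exact: l1continuous_coord.
- move=> a x; rewrite f0/= -[f x a]ger0_norm// -lee_fin -(f1 x).
  exact: normr_le_l1norm.
- by move=> x; rewrite -ge0_l1normE.
- move=> a x /=; apply: contra_neqP => nUax.
  apply: (@l1closure_coord _ _ _ [set 0] _ a _ _ (fU x)) => [|z [_ _ zU _]].
    exact: closed_eq.
  by apply: contra_notP nUax => /eqP /zU.
Qed.

End CoverSimplex.

(** * From partitions of unity to selections *)

Section SupRange.
Variables (R : realType) (T : Type).
Implicit Types f g : T -> R.

Lemma sup_range_ge f t : has_sup (range f) -> f t <= sup (range f).
Proof. by move=> fsup; apply: (sup_upper_bound fsup); exists t. Qed.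

Lemma sup_range_leD f g (e : R) : has_sup (range f) -> has_sup (range g) ->
  (forall t, f t <= g t + e) -> sup (range f) <= sup (range g) + e.
Proof.
move=> [f0 _] gsup fg; apply: ge_sup => // _ [t _ <-].
by apply: le_trans (fg t) _; rewrite lerD2r sup_range_ge.
Qed.

Lemma ler_dist_sup_range f g (e : R) : has_sup (range f) -> has_sup (range g) ->
  (forall t, `|f t - g t| <= e) -> `|sup (range f) - sup (range g)| <= e.
Proof.
move=> fsup gsup fg; rewrite ler_distlC; apply/andP; split.
  rewrite lerBlDr; apply: sup_range_leD => // t.
  by have := fg t; rewrite ler_distl => /andP[_]; lra.
apply: sup_range_leD => // t.
by have := fg t; rewrite ler_distl => /andP[+ _]; lra.
Qed.

End SupRange.

Section LocallyFinitePartition.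
Variables (R : realType) (X : topologicalType) (I : choiceType).
Implicit Types (i : I) (x : X).

Definition locally_finite_family (m : I -> X -> R) : Prop :=
  forall x0, exists F : {fset I}, \forall x \near x0, forall i, i \notin F -> m i x = 0.

Variable xi : I -> X -> R.
Hypothesis xi_partition : partition_of_unity xi.

Let xi_continuous i : continuous (xi i). Proof. by case: xi_partition. Qed.

Let xi_ge0 x i : 0 <= xi i x.
Proof. by case: xi_partition => _ [/(_ i x)/andP[]]. Qed.

Let xi_sum x : \esum_(i in [set: I]) (xi i x)%:E = 1%E.
Proof. by case: xi_partition => _ []. Qed.

Let xi_has_sup x : has_sup (range (xi^~ x)).
Proof.
split; last first.
  by exists 1 => _ [i _ <-]; case: xi_partition => _ [/(_ i x)/andP[]].
have [|F] := @lt_esum_fset _ _ (xi^~ x) 0; first by rewrite xi_sum lte_fin.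
have [->|[i _]] := fset_0Vmem F; first by rewrite big_seq_fset0 ltxx.
by exists (xi i x), i.
Qed.

Lemma partition_tail x0 (e : R) : 0 < e ->
  exists F : {fset I}, \forall x \near x0, forall i, i \notin F -> xi i x < e.
Proof.
move=> e0; have [|F F1] := @lt_esum_fset _ _ (xi^~ x0) (1 - e).
  by rewrite xi_sum lte_fin; lra.
exists F; have Fcvg : \sum_(i <- F) xi i x @[x --> x0] --> \sum_(i <- F) xi i x0.
  by apply: cvg_big => [|i _]; [exact: add_continuous|exact: xi_continuous].
apply: filterS (cvgr_gt _ Fcvg _ F1) => x Fx i iF.
have := esum_fset_lower (i |` F)%fset (xi_ge0 x).
by rewrite xi_sum lee_fin big_fsetU1//=; lra.
Qed.

Lemma partition_equicontinuous x0 (e : R) : 0 < e ->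
  \forall x \near x0, forall i, `|xi i x - xi i x0| <= e.
Proof.
move=> e0; have [F tailF] := partition_tail x0 e0; have tailx0 := nbhs_singleton tailF.
have nearF : \forall x \near x0, forall i, i \in F -> `|xi i x - xi i x0| <= e.
  apply: (@filter_bigI _ _ F (fun i => [set x | `|xi i x - xi i x0| <= e])) => i _.
  have /cvgrPdist_le/(_ _ e0) := @xi_continuous i x0.
  by apply: filterS => x /=; rewrite distrC.
apply: filterS2 tailF nearF => x tailx nearx i.
have [/nearx//|iF] := boolP (i \in F).
have := tailx i iF; have := tailx0 i iF.
have := xi_ge0 x i; have := xi_ge0 x0 i.
by move=> *; rewrite ler_norml; apply/andP; split; lra.
Qed.

Lemma partition_sup_continuous : continuous (fun x => sup (range (xi^~ x))).
Proof.
move=> x0; apply/cvgrPdist_le => e e0.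
apply: filterS (partition_equicontinuous x0 e0) => x xe.
by rewrite distrC; exact: ler_dist_sup_range.
Qed.

Lemma partition_sup_gt0 x : 0 < sup (range (xi^~ x)).
Proof.
rewrite ltNge; apply/negP => sup0.
have : (1 <= 0 :> \bar R)%E; last by rewrite lee_fin ler10.
rewrite -(xi_sum x) esum1// => i _; congr EFin; apply/eqP.
by rewrite eq_le xi_ge0 andbT; apply: le_trans sup0; exact: sup_range_ge.
Qed.

(* Mather's truncation: near a point only finitely many [xi i] exceed half of their
   supremum. *)
Definition half_sup_truncation (i : I) (x : X) : R :=
  Num.max (xi i x - sup (range (xi^~ x)) / 2) 0.

Lemma half_sup_truncation_ge0 i x : 0 <= half_sup_truncation i x.
Proof. by rewrite le_max lexx orbT. Qed.

Lemma half_sup_truncation_continuous i : continuous (half_sup_truncation i).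
Proof.
move=> x; apply: (@continuous_max R X _ (fun=> 0)); last exact: cvg_cst.
by apply: cvgB; [exact: xi_continuous|apply: cvgMl; exact: partition_sup_continuous].
Qed.

Lemma half_sup_truncation_support i x : half_sup_truncation i x != 0 -> xi i x != 0.
Proof.
apply: contraNneq => xi0; rewrite /half_sup_truncation xi0; apply/eqP/max_idPr.
by have := partition_sup_gt0 x; lra.
Qed.

Lemma half_sup_truncation_gt0 x : exists i, 0 < half_sup_truncation i x.
Proof.
have sup0 := partition_sup_gt0 x.
have half_lt : sup (range (xi^~ x)) / 2 < sup (range (xi^~ x)) by lra.
have [_ [i _ <-] half_xi] := sup_gt (xi_has_sup x).1 half_lt.
by exists i; rewrite lt_max subr_gt0 half_xi.
Qed.

Lemma half_sup_truncation_locally_finite : locally_finite_family half_sup_truncation.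
Proof.
move=> x0; have sup0 := partition_sup_gt0 x0.
have quarter0 : 0 < sup (range (xi^~ x0)) / 4 by rewrite divr_gt0.
have [F tailF] := partition_tail x0 quarter0; exists F.
have /cvgrPdist_le/(_ _ quarter0) := @partition_sup_continuous x0.
apply: filterS2 tailF => x tailx; rewrite ler_distl => /andP[_ supx] i /tailx xi4.
by apply/max_idPr; lra.
Qed.

End LocallyFinitePartition.

Section Barycenter.
Variables (R : realType) (A : choiceType).
Implicit Types (C : set (A -> R)).

Lemma convex_set_weighted_mean (I : eqType) C (s : seq I) (w : I -> R)
    (d : I -> A -> R) :
  Defs.convex_set C -> (forall i, 0 <= w i) -> (forall i, w i != 0 -> C (d i)) ->
  0 < \sum_(i <- s) w i ->
  C ((\sum_(i <- s) w i)^-1 *: \sum_(i <- s) w i *: d i).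
Proof.
move=> cC w0 Cd; elim: s => [|j s IH]; first by rewrite big_nil ltxx.
rewrite !big_cons; set W := \sum_(i <- s) w i in IH *.
have [wj|wj] := eqVneq (w j) 0; first by rewrite wj add0r scale0r add0r.
have : 0 <= W by exact: sumr_ge0.
rewrite le_eqVlt => /predU1P[W0 _|W0 _].
  have -> : \sum_(i <- s) w i *: d i = 0.
    move/esym/eqP: W0; rewrite psumr_eq0// => /allP ws.
    by rewrite big_seq big1// => i /ws/= /eqP ->; rewrite scale0r.
  by rewrite -W0 !addr0 scalerA mulVf// scale1r; exact: Cd.
have wj0 : 0 < w j by rewrite lt_def wj w0.
have wjW : w j + W != 0 by rewrite lt0r_neq0// addr_gt0.
have t0 : 0 <= w j / (w j + W) by rewrite divr_ge0// addr_ge0// ltW.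
have t1 : w j / (w j + W) <= 1 by rewrite ler_pdivrMr ?mul1r ?lerDl ?ltW// addr_gt0.
have := cC _ _ _ (Cd j wj) (IH W0) t0 t1; congr C.
rewrite scalerDr !scalerA; congr (_ *: _ + _ *: _); first by rewrite mulrC.
by field; rewrite wjW lt0r_neq0.
Qed.

Variables (X : topologicalType) (I : choiceType).
Variables (m : I -> X -> R) (d : I -> A -> R).
Hypotheses (m_ge0 : forall i x, 0 <= m i x) (m_gt0 : forall x, exists i, 0 < m i x).
Hypothesis m_locally_finite : locally_finite_family m.

Definition barycenter (x : X) : A -> R :=
  (\sum_(i \in [set: I]) m i x)^-1 *: \sum_(i \in [set: I]) m i x *: d i.

Lemma barycenterE (F : {fset I}) x : (forall i, i \notin F -> m i x = 0) ->
  barycenter x = (\sum_(i <- F) m i x)^-1 *: \sum_(i <- F) m i x *: d i.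
Proof.
move=> mF; rewrite /barycenter -!(fsbig_widen [set` F] setT)//; last 2 first.
- by move=> i [_ /negP/mF mi0]; rewrite /= mi0 scale0r.
- by move=> i [_ /negP/mF].
by rewrite -!fsbig_seq.
Qed.

Lemma sum_weights_gt0 (F : {fset I}) x : (forall i, i \notin F -> m i x = 0) ->
  0 < \sum_(i <- F) m i x.
Proof.
move=> mF; have [i mi] := m_gt0 x.
have iF : i \in F by apply: contraTT mi => /mF ->; rewrite ltxx.
by rewrite (big_fsetD1 i)//= ltr_pwDl// sumr_ge0.
Qed.

Lemma barycenter_convex C x : Defs.convex_set C ->
  (forall i, m i x != 0 -> C (d i)) -> C (barycenter x).
Proof.
move=> cC Cd; have [F nearF] := m_locally_finite x; have mF := nbhs_singleton nearF.
rewrite (barycenterE mF); apply: convex_set_weighted_mean => //.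
exact: sum_weights_gt0.
Qed.

Lemma barycenter_l1continuous : (forall i, continuous (m i)) ->
  (forall i, ell1 (d i)) -> l1continuous barycenter.
Proof.
move=> mc d1 x0 e e0; have [F nearF] := m_locally_finite x0.
have mF0 := nbhs_singleton nearF.
pose c i x := (\sum_(j <- F) m j x)^-1 * m i x.
have barE x : (forall i, i \notin F -> m i x = 0) ->
    barycenter x = \sum_(i <- F) c i x *: d i.
  move=> mF; rewrite (barycenterE mF) scaler_sumr.
  by apply: eq_bigr => i _; rewrite scalerA.
have cc i : {for x0, continuous (c i)}.
  apply: cvgM; last exact: mc.
  apply: cvgV; first by rewrite lt0r_neq0// sum_weights_gt0.
  by apply: cvg_big => [|j _]; [exact: add_continuous|exact: mc].
apply: filterS2 nearF (near_l1dist_sum F d1 cc e0) => x mFx.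
by rewrite -!barE.
Qed.

End Barycenter.

Definition index_partition_property (R : realType) (X : topologicalType)
    (A : choiceType) : Prop :=
  forall U : A -> set X, open_cover_indexed U ->
    exists xi : A -> X -> R, partition_of_unity xi /\ index_subordinated xi U.

Section Equivalence.
Variables (R : realType) (X : topologicalType) (A : choiceType) (S : set (A -> R)).
Hypotheses (c00S : @c00 R A `<=` S) (S_ell1 : S `<=` @ell1 R A).

Lemma partition_of_unity_selection (d : A -> A -> R) :
  (forall a, c00 (d a)) ->
  (forall y (e : R), S y -> 0 < e -> exists a, (l1dist y (d a) < e%:E)%E) ->
  index_partition_property R X A -> selection_property X S.
Proof.
move=> dc ddense partition Phi PhiS cPhi lPhi e e0.
pose U a := [set x | Phi x `&` (S `&` l1ball (d a) e) !=set0].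
have [|xi [xi_part xiU]] := partition U.
  split=> [a|]; first exact/lPhi/open_in_l1ball.
  apply/seteqP; split=> // x _; have [[y Py] PS] := PhiS x.
  have [a yd] := ddense y _ (PS _ Py) e0.
  by exists a => //; exists y; split=> //; split=> //; exact: PS.
have w_ge0 := half_sup_truncation_ge0 xi.
have w_gt0 := half_sup_truncation_gt0 xi_part.
have w_lf := half_sup_truncation_locally_finite xi_part.
exists (barycenter (half_sup_truncation xi) d); split; [split|] => [x||x].
- apply: c00S; apply: barycenter_convex => //; exact: c00_convex.
- apply: barycenter_l1continuous => // a; first exact: half_sup_truncation_continuous.
  exact: c00_ell1.
- suff : enlargement (Phi x) e (barycenter (half_sup_truncation xi) d x) by [].
  apply: barycenter_convex => // [|a]; first exact: enlargement_convex.
  move=> /(half_sup_truncation_support xi_part)/xiU[y [Py [_ yd]]].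
  by exists y => //; rewrite l1distC.
Qed.

Lemma selection_iff_index_partition : infinite_set [set: A] ->
  selection_property X S <-> index_partition_property R X A.
Proof.
move=> Ainf; split=> [selS U|]; first exact: selection_partition_of_unity c00S selS.
have [d [dc ddense]] := infinite_l1_dense_family R Ainf.
by apply: (partition_of_unity_selection dc) => y e /S_ell1; exact: ddense.
Qed.

End Equivalence.

Theorem theorem4p4 (R : realType) (X : topologicalType) (A : choiceType)
  (hA : infinite_set [set: A]) :
  (selection_property X (@c00 R A) <-> selection_property X (@ell1 R A)) /\
  (selection_property X (@ell1 R A) <->
    forall U : A -> set X, open_cover_indexed U ->
      exists xi : A -> X -> R, partition_of_unity xi /\ index_subordinated xi U).
Proof.
have c00_iff := selection_iff_index_partition X (@subset_refl _ _) (@c00_ell1 R A) hA.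
have ell1_iff := selection_iff_index_partition X (@c00_ell1 R A) (@subset_refl _ _) hA.
by split; [rewrite c00_iff ell1_iff|exact: ell1_iff].
Qed.
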